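(* Let $\mathbb{F}$ be a field, let $G$ be a finite group, and let $\rho : G \to \mathrm{GL}(\mathbb{F}^n)$ be an irreducible representation. Suppose that there are $q$ group elements $h_1,\ldots,h_q \in G$ and $q$ scalars $\alpha_1,\ldots,\alpha_q \in \mathbb{F}$ such that $$0 < \operatorname{rank}\left(\sum_{\ell=1}^q \alpha_\ell \rho(h_\ell)\right) \leq R.$$ Then there exists a linear $(q,\delta)$-LDC $A = (a_1,\ldots,a_m) \in (\mathbb{F}^t)^m$ with $$m = |G|, \quad t = \lceil n/R \rceil, \quad \text{and} \quad \delta = \theta_{\mathbb{F}}/q^2.$$
   Context: The constant $\theta_{\mathbb{F}}$ is defined by $\theta_{\mathbb{F}} = 1$ if $\mathbb{F}$ is infinite, and $\theta_{\mathbb{F}} = 1 - \frac{1}{|\mathbb{F}|}$ otherwise. Write $[m]=\{1,\ldots,m\}$. $q$-matching: for integers $m,q\ge 1$, a $q$-matching over $[m]$ is a family $M$ of subsets of $[m]$ such that every $S\in M$ has $|S|=q$ and any two distinct $S,T\in M$ satisfy $S\cap T=\emptyset$. Its size $|M|$ is the number of sets in $M$. Linear $(q,\delta)$-LDC (Locally Decodable Code): for integers $q,t,m\ge 1$ and $\delta\in[0,1]$, a sequence $A=(a_1,\ldots,a_m)\in(\mathbb{F}^t)^m$ of $m$ vectors in $\mathbb{F}^t$ is a linear $(q,\delta)$-LDC if for all $i\in[t]$ there exists a $q$-matching $M_i$ over $[m]$ such that (1) for every $S\in M_i$, the $i$-th standard basis vector $\mathbf{e}_i\in\mathbb{F}^t$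 is spanned by the set $\{a_j : j\in S\}$; and (2) $\sum_{i=1}^t |M_i|\ge \delta m t$.
   Formalization: The formal theorem adds the hypothesis q ≤ |G| (automatic if h_1,…,h_q are distinct); with repeated elements and q > |G| no q-subset of [m] exists, so every q-matching is empty and the claim fails, e.g. G trivial, n = R = 1, q = 2, α = (1,0). *)

(* Defs.v *)
From HB Require Import structures.
From mathcomp Require Import all_boot all_order all_algebra all_fingroup.
From mathcomp Require Import mxrepresentation.
From mathcomp Require Import finmap boolp classical_sets cardinality reals.

Set Implicit Arguments.
Unset Strict Implicit.
Unset Printing Implicit Defensive.

Import Order.TTheory GRing.Theory Num.Theory.
Local Open Scope ring_scope.

Definition theta (K : realType) (F : fieldType) : K :=
  if `[< finite_set [set: F]%classic >]
  then 1 - 1 / #|` fset_set [set: F]%classic |%:R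
  else 1.

(* The sets in M have exactly q elements, so M is empty as soon as m < q:
   this is why q <= #|G| must be assumed when group elements may repeat.
   trivIset is qualified since classical_sets shadows the one on {set _}. *)
Definition q_matching (m q : nat) (M : {set {set 'I_m}}) : Prop :=
  (forall S, S \in M -> #|S| = q) /\ finset.trivIset M.

Definition linear_LDC (K : realType) (F : fieldType) (m t q : nat) (delta : K)
    (a : 'I_m -> 'rV[F]_t) : Prop :=
  exists M : 'I_t -> {set {set 'I_m}},
    [/\ forall i, q_matching q (M i),
        forall i S, S \in M i ->
          delta_mx 0 i \in <<[seq a j | j in S]>>%VS
      & delta * m%:R * t%:R <= (\sum_(i < t) #|M i|)%N%:R].

(* Main.v *)
Require Import Defs.
From HB Require Import structures.
From mathcomp Require Import all_boot all_order all_algebra all_fingroup.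
From mathcomp Require Import mxrepresentation.
From mathcomp Require Import finmap boolp classical_sets cardinality reals.
From mathcomp Require Import zify.

(** Let D be the operator of rank at most R built from the h l. By
    irreducibility the row spaces of the translates D rho(k), k in G, together
    span the whole space, so a minimal subfamily B that still spans has at least
    n / R members. Minimality gives, for each k in B, a functional f k that
    vanishes on the row spaces of D rho(k') for the other k' in B but not on
    the row space of D rho(k) (exists_dual_functionals).

    Pick t members k_1, ..., k_t of B and a row vector v, and encode g in G by
    the vector a_g with coordinates v rho(g) f(k_i). Multiplicativity of rho
    gives, for every g and i,
      sum_l alpha_l a_(g h_l k_i) = (v rho(g) D rho(k_i) f(k_i)) e_i,
    because the off-diagonal coordinates vanish. Hence the q points g h_l k_i
    decode e_i as soon as the scalar on the right is nonzero.

    That scalar is a nonzero linear form in v, so it vanishes with probability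
    at most 1 / s when the coordinates of v are random in a set of s scalars.
    With s the order of a finite field, or s large in an infinite field, some v
    makes at least a proportion theta of the pairs (g, i) good
    (exists_vector_theta).

    It remains, for fixed i, to extract disjoint query sets from the good g.
    Right multiplication by h_l k_i is injective, so a point lies in the query
    sets of at most q elements g; hence a chosen set of q points spoils at most
    q^2 of them, and a maximal matching keeps a proportion 1 / q^2
    (exists_matching). The elements g h_l k_i may coincide for different l, so
    query sets are padded with unused points up to size q. *)

Set Implicit Arguments.
Unset Strict Implicit.
Unset Printing Implicit Defensive.

Import Order.TTheory GRing.Theory Num.Theory.
Local Open Scope ring_scope.

(** * Avoiding the zeros of many linear forms *)

Definition tabulated (F : fieldType) (n : nat) (A : seq F)
    (w : {ffun 'I_n -> 'I_(size A)}) : 'rV[F]_n :=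
  \row_j nth 0 A (w j).

(** Away from a coordinate j with x j != 0 the entries of a vector killed by x
    are arbitrary, and they determine the j-th entry. So overwriting the j-th
    entry freely is injective on pairs of a killed vector and a new entry. *)
Lemma card_tabulated_kernel (F : fieldType) (n : nat) (A : seq F)
    (x : 'cV[F]_n) : uniq A -> x != 0 ->
  (size A * #|[set w | tabulated (A := A) w *m x == 0%R]| <= size A ^ n)%N.
Proof.
move=> uniqA /cV0Pn[j xj0].
set Z := [set w | _].
pose upd (p : {ffun 'I_n -> 'I_(size A)} * 'I_(size A)) :=
  [ffun i => if i == j then p.2 else p.1 i].
have upd_inj : {in finset.setX Z [set: 'I_(size A)] &, injective upd}.
  move=> [w c] [w' c']; rewrite !inE /= !andbT => /eqP wx0 /eqP w'x0 /ffunP eq_u.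
  have eq_off i : i != j -> w i = w' i.
    by move=> /negPf ne; have := eq_u i; rewrite !ffunE ne.
  have -> : c = c' by have := eq_u j; rewrite !ffunE eqxx.
  congr (_, _); apply/ffunP => i; have [->{i}|/eq_off//] := eqVneq i j.
  have /matrixP/(_ 0 0) : (tabulated w - tabulated w') *m x = 0.
    by rewrite mulmxBl wx0 w'x0 subrr.
  rewrite !mxE (bigD1 j) //= big1 => [|i ne_ij]; last first.
    by rewrite !mxE eq_off // subrr mul0r.
  rewrite addr0 !mxE => /eqP; rewrite mulf_eq0 (negPf xj0) orbF subr_eq0.
  by rewrite nth_uniq // => /eqP/val_inj.
have := max_card (mem (upd @: finset.setX Z [set: 'I_(size A)])).
by rewrite card_in_imset // cardsX cardsT card_ffun !card_ord mulnC.
Qed.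

(** First moment argument: a uniform vector with entries in A is killed by each
    x p with probability at most 1 / size A. *)
Lemma exists_vector_few_zeros (F : fieldType) (n : nat) (A : seq F)
    (I : finType) (x : I -> 'cV[F]_n) :
    uniq A -> (0 < size A)%N -> (forall p, x p != 0) ->
  exists v : 'rV[F]_n, (size A * #|[set p | v *m x p == 0%R]| <= #|I|)%N.
Proof.
move=> uniqA A_gt0 x0; apply: contrapT => noV.
have bad w : (#|I| < size A * #|[set p | tabulated (A := A) w *m x p == 0%R]|)%N.
  by rewrite ltnNge; apply/negP => le; apply: noV; exists (tabulated (A := A) w).
suff : (\sum_(w : {ffun 'I_n -> 'I_(size A)}) #|I|.+1 <= #|I| * size A ^ n)%N.
  rewrite sum_nat_const card_ffun !card_ord mulnC leqNgt ltn_pmul2r ?ltnSn //.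
  by rewrite expn_gt0 A_gt0.
apply: (@leq_trans
  (\sum_w size A * #|[set p | tabulated (A := A) w *m x p == 0%R]|)%N).
  by apply: leq_sum => w _; apply: bad.
under eq_bigr do rewrite -sum1dep_card big_mkcond.
rewrite -big_distrr /= exchange_big big_distrr /=.
rewrite -sum_nat_const; apply: leq_sum => p _.
by rewrite -big_mkcond sum1dep_card card_tabulated_kernel.
Qed.

(** Over a finite field the entries range over the whole field. Over an infinite
    one they range over a set with more than #|I| elements, which makes the
    number of zeros less than 1. *)
Lemma exists_vector_theta (K : realType) (F : fieldType) (n : nat)
    (I : finType) (x : I -> 'cV[F]_n) : (forall p, x p != 0) ->
  exists v : 'rV[F]_n,
    theta K F * #|I|%:R <= #|[set p | v *m x p != 0]|%:R :> K.
Proof.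
move=> x0.
have cardC (v : 'rV[F]_n) :
    #|I| = (#|[set p | v *m x p == 0%R]| + #|[set p | v *m x p != 0%R]|)%N.
  rewrite -(cardsC [set p | v *m x p == 0]); congr addn.
  by apply: eq_card => p; rewrite !inE.
rewrite /theta; case: asboolP => [finF|infF].
  set A := fset_set _.
  have A_gt0 : (0 < size A)%N.
    by rewrite cardfs_gt0; apply/fset0Pn; exists 0; rewrite in_fset_set // inE.
  have [v le_v] := exists_vector_few_zeros (fset_uniq A) A_gt0 x0.
  exists v; rewrite [in leLHS](cardC v).
  move: le_v; rewrite (cardC v) -(ler_nat K) natrM.
  have s_gt0 : 0 < (size A)%:R :> K by rewrite ltr0n.
  move=> le_v; rewrite mulrBl !mul1r lerBlDr [in leLHS]natrD [leLHS]addrC.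
  by rewrite lerD2l ler_pdivlMl.
have [A _ A_big] := infinite_set_fset #|I|.+1 infF.
have [v le_v] := exists_vector_few_zeros (fset_uniq A) (leq_ltn_trans (leq0n _) A_big) x0.
exists v; rewrite mul1r ler_nat [leqLHS](cardC v).
suff -> : #|[set p | v *m x p == 0]| = 0%N by [].
apply/eqP; rewrite -leqn0 leqNgt; apply/negP => bad_gt0.
have := leq_trans A_big (leq_trans (leq_pmulr _ bad_gt0) le_v).
by rewrite ltnn.
Qed.

(** * Disjoint query sets *)

Lemma exists_superset_card (T : finType) (U V : {set T}) (q : nat) :
    U \subset V -> (#|U| <= q <= #|V|)%N ->
  exists S : {set T}, [/\ U \subset S, S \subset V & #|S| = q].
Proof.
move=> sUV /andP[leUq leqV].
pose s := take (q - #|U|) (enum (V :\: U)).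
have sP x : x \in s -> (x \notin U) && (x \in V).
  by move/mem_take; rewrite mem_enum inE.
exists (U :|: [set:: s]); split; first exact: finset.subsetUl.
  rewrite finset.subUset sUV /=; apply/fintype.subsetP => x; rewrite inE => /sP/andP[] //.
rewrite cardsU (_ : U :&: _ = finset.set0) ?cards0 ?subn0; last first.
  by apply/setP => x; rewrite !inE; apply/andP => -[xU /sP]; rewrite xU.
have us : uniq s by rewrite take_uniq // enum_uniq.
rewrite cardsE (card_uniqP us) size_take_min -cardE cardsD.
by rewrite (finset.setIidPr sUV) (minn_idPl _) ?leq_sub2r // subnKC.
Qed.

(** The set of the c l g for l : 'I_q is the query set of g. In a matching that
    is maximal for inclusion, some query set avoiding it would exist if more
    than #|M| q^2 elements were available, since each of the #|M| q covered
    points meets at most q query sets. *)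
Lemma exists_matching (I T : finType) (q : nat) (c : 'I_q -> I -> T)
    (B : {set I}) :
    (0 < q <= #|T|)%N -> (#|B| <= #|T|)%N ->
    (forall l, {in B &, injective (c l)}) ->
  exists M : {set {set T}},
    [/\ (forall S, S \in M -> #|S| = q), finset.trivIset M,
        (forall S, S \in M -> exists2 g, g \in B & forall l, c l g \in S)
      & (#|B| <= #|M| * q ^ 2)%N].
Proof.
move=> /andP[q_gt0 leqT] leBT c_inj.
pose P (M : {set {set T}}) := finset.trivIset M && [forall S in M,
  (#|S| == q) && [exists g in B, [forall l, c l g \in S]]].
have P0 : P finset.set0.
  apply/andP; split; first by apply/finset.trivIsetP => S ?; rewrite inE.
  by apply/forall_inP => S; rewrite inE.
have [M /maxsetP[/andP[tM /forall_inP PM] maxM] _] := maxset_exists P0.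
have cardS S : S \in M -> #|S| = q by move/PM/andP=> [/eqP].
exists M; split=> // [S /PM/andP[_ /exists_inP[g gB /forallP cg]]|].
  by exists g.
rewrite leqNgt; apply/negP => ltMB.
set C := finset.cover M.
have cardC : #|C| = (#|M| * q)%N.
  by rewrite -(eqP tM) (eq_bigr _ cardS) sum_nat_const.
have [g gB gC] : exists2 g, g \in B & forall l, c l g \notin C.
  apply: contrapT => noB; move: ltMB; rewrite ltnNge => /negP[].
  have sub : B \subset \bigcup_(l < q) [set g in B | c l g \in C].
    apply/fintype.subsetP => g gB; apply: contrapT => gN; apply: noB; exists g => // l.
    by apply/negP => cC; apply: gN; apply/bigcupP; exists l; rewrite // inE gB.
  apply: leq_trans (subset_leq_card sub) _.
  apply: leq_trans (_ : \sum_(l < q) #|C| <= _)%N; last first.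
    by rewrite sum_nat_const card_ord cardC mulnC -mulnA.
  elim/big_ind2: _ => [|S1 n1 S2 n2 le1 le2|l _]; first by rewrite cards0.
    by rewrite (leq_trans (leq_card_setU _ _)) ?leq_add.
  have inj_l : {in [set g in B | c l g \in C] &, injective (c l)}.
    by move=> x y; rewrite !inE => /andP[xB _] /andP[yB _]; apply: c_inj.
  rewrite -(card_in_imset inj_l); apply/subset_leq_card/fintype.subsetP => y.
  by case/imsetP => x; rewrite inE => /andP[_ xC] ->.
pose U := [set c l g | l : 'I_q].
have sUC : U \subset ~: C.
  by apply/fintype.subsetP => _ /imsetP[l _ ->]; rewrite inE gC.
have cardU : (#|U| <= q <= #|~: C|)%N.
  rewrite (leq_trans (leq_imset_card _ _)) ?card_ord //=.
  rewrite cardsCs finset.setCK cardC.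
  (* Room for padding: if M is nonempty then #|M| q^2 < #|T| leaves q unused
     points, and if M is empty this is q <= #|T|. *)
  have := leq_trans ltMB leBT.
  nia.
have [S [sUS sSC cSq]] := exists_superset_card sUC cardU.
have M0 : finset.set0 \notin M.
  by apply/negP => /cardS; rewrite cards0 => q0; rewrite -q0 in q_gt0.
have disjS S' : S' \in M -> [disjoint S & S'].
  move=> S'M; rewrite finset.disjoints_subset (fintype.subset_trans sSC) // finset.setCS.
  exact: finset.bigcup_sup.
have [tSM SM] := trivIsetU1 disjS tM M0.
have PSM : P (S |: M).
  rewrite /P tSM; apply/forall_inP => S1; rewrite !inE => /predU1P[->|/PM//].
  rewrite cSq eqxx /=; apply/exists_inP; exists g => //.
  by apply/forallP => l; apply: (fintype.subsetP sUS); apply: imset_f.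
by move: SM; rewrite -(maxM _ PSM (finset.subsetUr _ _)) !inE eqxx.
Qed.

(** * Dual functionals for the translates of an operator *)

(** Take B minimal such that the W k, k in B, still span. Then W k is not
    contained in the sum H k of the others, so a column of the cokernel of H k
    kills H k but not W k. The size bound is subadditivity of rank. *)
Lemma exists_dual_functionals (F : fieldType) (I : finType) (n r : nat)
    (W : I -> 'M[F]_n) (G : {set I}) :
    (1%:M <= \sum_(k in G) W k)%MS -> (forall k, k \in G -> \rank (W k) <= r)%N ->
  exists (B : {set I}) (f : I -> 'cV[F]_n),
    [/\ B \subset G, (n <= #|B| * r)%N,
        forall k, k \in B -> W k *m f k != 0
      & {in B &, forall k j, k != j -> W k *m f j = 0}].
Proof.
move=> fullG rW.
pose P (B : {set I}) := (1%:M <= \sum_(k in B) W k)%MS.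
have [B /minsetP[PB minB] sBG] := minset_exists (P := P) fullG.
pose H k := (\sum_(j in B :\ k) W j)%MS.
have WH k : k \in B -> W k *m cokermx (H k) != 0.
  move=> kB; rewrite -submxE; apply/negP => sWH.
  have PBk : P (B :\ k).
    by apply: submx_trans PB _; rewrite (finset.big_setD1 k) //= addsmx_sub sWH /=.
  by have := setD11 k B; rewrite (minB _ PBk (subD1set _ _)) kB.
have exf k : exists f : 'cV[F]_n,
    (k \in B -> W k *m f != 0) /\ forall j, j \in B -> j != k -> W j *m f = 0.
  have [kB|kB] := boolP (k \in B); last first.
    by exists 0; split=> // j _ _; rewrite mulmx0.
  have [i [j ij]] := matrix0Pn _ (WH k kB).
  exists (col j (cokermx (H k))); split=> [_|l lB ne_lk].
    by apply/matrix0Pn; exists i, 0; rewrite colE mulmxA -colE mxE.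
  rewrite colE mulmxA -colE (_ : W l *m _ = 0) ?linear0 //; apply/eqP.
  by rewrite -submxE (sumsmx_sup l) // !inE ne_lk.
have [f fP] := choice exf.
exists B, f; split=> // [|k kB|k j kB jB]; last 2 first.
- by case: (fP k) => /(_ kB).
- by case: (fP j) => _; apply.
move: PB; rewrite /P sub1mx => /eqP/esym/eq_leq/leq_trans; apply.
rewrite -sum_nat_const.
have le_r : (\sum_(k in B) \rank (W k) <= \sum_(k in B) r)%N.
  by apply: leq_sum => k /(fintype.subsetP sBG)/rW.
apply: leq_trans le_r.
exact: mxrank_sum_leqif.
Qed.

(** The sum is a nonzero submodule, because right multiplication by rho x
    permutes its summands. *)
Lemma irreducible_translates_full (F : fieldType) (gT : finGroupType)
    (G : {group gT}) (n : nat) (rho : mx_representation F G n) (D : 'M[F]_n) :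
    mx_irreducible rho -> D != 0 ->
  (1%:M <= \sum_(k in G) D *m rho k)%MS.
Proof.
move=> /mx_irrP[_ irr] D0; rewrite sub1mx; apply: irr.
  apply/mxmoduleP => x xG; rewrite sumsmxMr.
  apply/sumsmx_subP => k kG; apply: (sumsmx_sup (k * x)%g); first exact: groupM.
  by rewrite -mulmxA repr_mxM.
apply: contra D0 => /eqP sum0; rewrite -submx0 -sum0.
by rewrite (sumsmx_sup 1%g) // repr_mx1 mulmx1.
Qed.

(** * The code *)

Theorem theorem1p5 (K : realType) (F : fieldType) (gT : finGroupType)
    (G : {group gT}) (n : nat) (rho : mx_representation F G n)
    (rho_irr : mx_irreducible rho)
    (q R : nat) (h : 'I_q -> gT) (alpha : 'I_q -> F)
    (h_in_G : forall l, h l \in G)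
    (q_le_G : (q <= #|G|)%N)
    (rank_gt0 : (0 < \rank (\sum_(l < q) alpha l *: rho (h l))%R)%N)
    (rank_le : (\rank (\sum_(l < q) alpha l *: rho (h l))%R <= R)%N) :
  exists a : 'I_#|G| -> 'rV[F]_(`|Num.ceil (n%:R / R%:R : K)|%N),
    linear_LDC q (theta K F / q%:R ^+ 2) a.
Proof.
set t := `|_|%N; set D := \sum_(l < q) _ in rank_gt0 rank_le.
have q_gt0 : (0 < q)%N.
  case: (posnP q) => // q0; move: rank_gt0; rewrite /D big1 ?mxrank0 // => l.
  by have := leq_trans (ltn_ord l) (eq_leq q0).
have R_gt0 := leq_trans rank_gt0 rank_le.
have D0 : D != 0 by rewrite -mxrank_eq0 -lt0n.
have rankW k : k \in G -> (\rank (D *m rho k) <= R)%N.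
  by move=> _; apply: leq_trans (mxrankM_maxl _ _) rank_le.
have [B [f [sBG n_le fdiag foff]]] :=
  exists_dual_functionals (irreducible_translates_full rho_irr D0) rankW.
have t_le : (t <= #|B|)%N.
  have : Num.ceil (n%:R / R%:R : K) <= #|B|%:Z.
    by rewrite ceil_le_int ler_pdivrMr ?ltr0n // -natrM ler_nat.
  have : 0 <= Num.ceil (n%:R / R%:R : K).
    by rewrite -(ceil0 K) le_ceil // divr_ge0.
  by rewrite /t; case: (Num.ceil _).
pose k (i : 'I_t) := enum_val (widen_ord t_le i).
have kB i : k i \in B by apply: enum_valP.
have kG i : k i \in G := fintype.subsetP sBG _ (kB i).
have k_inj : injective k by move=> i j /enum_val_inj/(congr1 val)/= /val_inj.
pose el (j : 'I_#|G|) : gT := enum_val j.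
have elG j : el j \in G by apply: enum_valP.
pose x (p : 'I_t * 'I_#|G|) := rho (el p.2) *m (D *m rho (k p.1) *m f (k p.1)).
have x0 p : x p != 0.
  apply: contra (fdiag _ (kB p.1)) => /eqP xp0.
  by rewrite -(mulKmx (repr_mx_unit rho (elG p.2)) (_ *m f _)) -/(x p) xp0 mulmx0.
have [v theta_le] := exists_vector_theta K x0.
pose a (j : 'I_#|G|) := \row_(i < t) (v *m rho (el j) *m f (k i)) 0 0.
exists a.
pose c i l j := enum_rank_in (group1 G) (el j * h l * k i)%g : 'I_#|G|.
have el_c i l j : el (c i l j) = (el j * h l * k i)%g.
  by rewrite /el /c enum_rankK_in // !groupM.
pose good i := [set j | v *m x (i, j) != 0].
have matching i : exists M : {set {set 'I_#|G|}},
    [/\ (forall S, S \in M -> #|S| = q), finset.trivIset M,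
        (forall S, S \in M -> exists2 j, j \in good i & forall l, c i l j \in S)
      & (#|good i| <= #|M| * q ^ 2)%N].
  apply: exists_matching; rewrite ?card_ord ?q_gt0 //.
    by have := max_card (mem (good i)); rewrite card_ord.
  move=> l j j' _ _ /(congr1 el); rewrite !el_c => /mulIg/mulIg.
  exact: enum_val_inj.
have [M MP] := choice matching.
exists M; split=> [i|i S SM|].
- by case: (MP i).
- case: (MP i) => _ _ /(_ S SM)[j]; rewrite inE => vx0 cS _.
  have decode : \sum_(l < q) alpha l *: a (c i l j) =
            (v *m x (i, j)) 0 0 *: delta_mx 0 i.
    apply/rowP => i'; rewrite summxE.
    have -> : \sum_(l < q) (alpha l *: a (c i l j)) 0 i' =
        (v *m rho (el j) *m (D *m rho (k i) *m f (k i'))) 0 0.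
      rewrite /D !mulmx_suml mulmx_sumr summxE; apply: eq_bigr => l _.
      rewrite mxE [in LHS]mxE el_c !repr_mxM ?groupM // -!scalemxAl -scalemxAr.
      by rewrite !mulmxA [RHS]mxE.
    have [->|ne_i] := eqVneq i' i.
      by rewrite [RHS]mxE [X in _ * X]mxE !eqxx mulr1 !mulmxA.
    rewrite foff ?mulmx0 ?mxE ?(negPf ne_i) ?mulr0 //.
    by apply: contra ne_i => /eqP/k_inj->.
  have vx00 : (v *m x (i, j)) 0 0 != 0.
    by apply: contra vx0 => /eqP e; rewrite [v *m _]mx11_scalar e raddf0.
  rewrite -[delta_mx _ _](scalerK vx00) -decode memvZ // memv_suml // => l _.
  by rewrite memvZ // memv_span // fintype.image_f.
have q2_gt0 : 0 < q%:R ^+ 2 :> K by rewrite exprn_gt0 // ltr0n.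
rewrite -mulrA -natrM mulrAC ler_pdivrMr //.
have cardI : #|{: 'I_t * 'I_#|G|}| = (#|G| * t)%N.
  by rewrite card_prod !card_ord mulnC.
rewrite -cardI (le_trans theta_le) // -natrX -natrM ler_nat big_distrl /=.
have -> : #|[set p | v *m x p != 0%R]| = (\sum_i #|good i|)%N.
  under [RHS]eq_bigr do rewrite -sum1dep_card.
  by rewrite pair_big_dep -sum1dep_card; apply: eq_bigl => -[].
by apply: leq_sum => i _; case: (MP i).
Qed.
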